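(* Let $p>1$ and $p'=p/(p-1)$. Let $f:(0,\infty)\to[0,\infty)$ be measurable with $f\in L^p(0,\infty)$. Put $$h(x)=\frac1x\int_0^x f(t)\,dt,\qquad x>0,$$ and $$\Phi_p(r)=r^p-1-p(r-1),\qquad r\ge 0.$$ Then $$(p')^p\int_0^\infty f(x)^p\,dx-\int_0^\infty h(x)^p\,dx=\int_0^\infty h(x)^p\,\Phi_p\!\left(\frac{p'f(x)}{h(x)}\right)dx ,$$ where at points $x$ with $h(x)=0$ the integrand on the right-hand side is understood as $0$. In particular, the identity holds when $f$ is in addition compactly supported and locally bounded.
   Context: All integrals are Lebesgue integrals. If one of the terms is infinite, the identity is understood in the usual extended sense. If $h(x)=0$ then, since $f\ge0$, $f=0$ almost everywhere on $(0,x)$. *)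

(* Defs.v *)
From HB Require Import structures.
From mathcomp Require Import all_boot all_order all_algebra.
From mathcomp Require Import all_classical all_reals all_analysis.

Set Implicit Arguments.
Unset Strict Implicit.
Unset Printing Implicit Defensive.
Import Order.TTheory GRing.Theory Num.Theory.
Import numFieldNormedType.Exports.

Local Open Scope classical_set_scope.
Local Open Scope ring_scope.

(* [measurable_fun] on [R] itself refers to the Borel sigma-algebra.  Here the
   domain carries the Lebesgue sigma-algebra (the Caratheodory-measurable sets
   of the Lebesgue outer measure, on which [completed_lebesgue_measure] lives);
   the codomain keeps the Borel one. *)
Definition lebesgue_measurable_fun (R : realType) (D : set R) (f : R -> R) :=
  @measurable_fun _ _ (caratheodory_type (@wlength R idfun)^*%mu) R D f.

(* [Rintegral] is 0 when the integral is infinite; this does not happen for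
   [f] in L^p(0, oo), whose integral over ]0, x[ is finite. *)
Definition hardy_mean (R : realType) (f : R -> R) (x : R) : R :=
  x^-1 * Rintegral completed_lebesgue_measure `]0, x[ f.

Definition Phi (R : realType) (p r : R) : R := r `^ p - 1 - p * (r - 1).

Definition hardy_remainder (R : realType) (p : R) (f : R -> R) (x : R) : R :=
  let h := hardy_mean f x in
  if h == 0 then 0 else h `^ p * Phi p (p / (p - 1) * f x / h).

Definition hardy_identity (R : realType) (p : R) (f : R -> R) : Prop :=
  ((((p / (p - 1)) `^ p)%:E *
      \int[completed_lebesgue_measure]_(x in `]0%R, +oo[) (f x `^ p)%:E)
   - \int[completed_lebesgue_measure]_(x in `]0%R, +oo[) (hardy_mean f x `^ p)%:E
   = \int[completed_lebesgue_measure]_(x in `]0%R, +oo[)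
       (hardy_remainder p f x)%:E)%E.

(* The support relative to the open set [D] is the closure in [D] of the
   nonzero locus; it is compact iff the closure in [R] is compact and lies in
   [D]. *)
Definition compactly_supported_on (R : realType) (D : set R) (f : R -> R) :=
  let S := closure [set x | D x /\ f x != 0] in compact S /\ S `<=` D.

Definition locally_bounded_on (R : realType) (D : set R) (f : R -> R) :=
  forall x, D x -> exists2 U, nbhs x U & [bounded f y | y in U `&` D].

(* Main.v *)
Require Import Defs.
From HB Require Import structures.
From mathcomp Require Import all_boot all_order all_algebra.
From mathcomp Require Import all_classical all_reals all_analysis.
From mathcomp Require Import measurable_realfun.
From mathcomp Require Import ring lra.

Set Implicit Arguments.
Unset Strict Implicit.
Unset Printing Implicit Defensive.
Import Order.TTheory GRing.Theory Num.Theory.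
Import numFieldNormedType.Exports.

Local Open Scope classical_set_scope.
Local Open Scope ring_scope.

(** Write [q = p / (p - 1)], [F x] for the integral of [f] over [(0, x)], so
that [h = F / x].  Expanding [Phi], where [h != 0] the remainder equals
[q^p f^p + (p - 1) h^p - p q f h^(p-1)], and where [h = 0] the function [f]
vanishes almost everywhere ([primitive_eq0_ae]), so this expression is [0]
too.  Hence the theorem follows from the finiteness of the integral of [h^p]
together with the balance
  [\int h^p = q \int f h^(p-1)]                        ([integral_mean_powR]).

The balance is an integration by parts, but carried out with Tonelli's theorem
it needs neither boundary terms nor finiteness: the chain rule
[F(x)^p = \int_(0, x) p F^(p-1) f] ([primitive_powR]) gives
  [\int x^(-p) F(x)^p dx = \int p F(t)^(p-1) f(t) (\int_(t, oo) x^(-p) dx) dt]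
and the inner integral is [t^(1-p) / (p - 1)].

The chain rule is proved without differentiating [F], which would require
Lebesgue's differentiation theorem.  Over [[a, b)] both [F^p] and the integral
of [p F^(p-1) f] increase by an amount lying between [p F(a)^(p-1) (F b - F a)]
and [p F(b)^(p-1) (F b - F a)].  Their difference, read as a function of the
value [s = F x] (legitimate since [F] is continuous and monotone), thus has
second-order increments and is constant ([eq_of_small_increments]).

Finiteness of [\int h^p] is Hardy's inequality ([hardy_inequality]).  Young's
inequality [p q f h^(p-1) <= q^p f^p + (p - 1) h^p] turns the balance into
[\int h^p <= q^p \int f^p] as soon as the left-hand side is finite; this holds
when [f] is cut off to [[1/n, n)] ([trunc]), for then [F] vanishes near [0] and is
bounded, and monotone convergence removes the cut-off.

Two sigma-algebras are involved: [f] is Lebesgue measurable, while [F], [h] and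
the powers of [x] are Borel.  The argument is therefore written for a measure
space [(L, mu)] with a real coordinate [i : L -> R] whose distribution is
Lebesgue measure; [f] lives on [L], and [F] and [h] are functions of the
coordinate.  The theorem is the case where [L] is the line with its
Lebesgue-measurable sets and [i] is the identity. *)

(** * Real inequalities *)

(** The weighted inequality of Young for the conjugate exponents [p] and
[p / (p - 1)], applied to [u] and [v ^ (p - 1)]. *)
Lemma young_powR (R : realType) (p u v : R) : 1 < p -> 0 <= u -> 0 <= v ->
  p * (u * v `^ (p - 1)) <= u `^ p + (p - 1) * v `^ p.
Proof.
move=> p1 u0 v0.
have p0 : 0 < p by lra.
have pm0 : 0 < p - 1 by lra.
have := @conjugate_powR _ u (v `^ (p - 1)) p (p / (p - 1)) u0 (powR_ge0 _ _) p0.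
rewrite divr_gt0// => /(_ isT).
have e1 : p^-1 + (p / (p - 1))^-1 = 1 by field; lra.
have e2 : (p - 1) * (p / (p - 1)) = p by field; lra.
rewrite -powRrM e1 e2.
move=> /(_ erefl) H.
rewrite -(ler_pM2l p0) in H; apply: (le_trans H).
by rewrite le_eqVlt; apply/orP; left; apply/eqP; field; lra.
Qed.

(** Tangent-line bounds for the convex function [x ^ p]; both sides are Young's
inequality, applied to [(a, b)] and to [(b, a)]. *)
Lemma powR_sub_bounds (R : realType) (p a b : R) : 1 < p -> 0 <= a -> 0 <= b ->
  p * a `^ (p - 1) * (b - a) <= b `^ p - a `^ p <= p * b `^ (p - 1) * (b - a).
Proof.
move=> p1 a0 b0.
have e x : 0 <= x -> x `^ p = x * x `^ (p - 1).
  by move=> x0; rewrite mulr_powRB1//; lra.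
have := young_powR p1 a0 b0; have := young_powR p1 b0 a0.
rewrite !e//; set A := a `^ _; set B := b `^ _ => H1 H2.
apply/andP; split; nra.
Qed.

(** On a subdivision of [[0, M]] into [n] equal steps the increments of [d] are
at most [M / n] times those of [g], and the latter telescope: [d M - d 0] is at
most [(g M - g 0) * (M / n)] for every [n]. *)
Lemma eq_of_small_increments (R : realType) (d g : R -> R) (M : R) :
  0 <= M ->
  (forall r s, 0 <= r -> r < s -> s <= M ->
     `|d s - d r| <= (g s - g r) * (s - r)) ->
  d M = d 0.
Proof.
move=> M0; rewrite le_eqVlt in M0; case/orP: M0 => [/eqP <-//|M0 dg].
have key (n : nat) : `|d M - d 0| <= (g M - g 0) * (M / n.+1%:R).
  pose t (i : nat) := i%:R * (M / n.+1%:R).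
  have h0 : 0 < M / n.+1%:R by rewrite divr_gt0.
  have tS i : t i.+1 - t i = M / n.+1%:R by rewrite /t -mulrBl -natrB// subSnn mul1r.
  have tn : t n.+1 = M by rewrite /t mulrC divfK.
  have t0 : t 0 = 0 by rewrite /t mul0r.
  have tele (k : R -> R) : k M - k 0 = \sum_(0 <= i < n.+1) (k (t i.+1) - k (t i)).
    by rewrite (@telescope_sumr _ 0 n.+1 (fun i => k (t i)))// tn t0.
  rewrite (tele d) (tele g) mulr_suml.
  apply: le_trans (ler_norm_sum _ _ _) _.
  rewrite big_nat_cond [leRHS]big_nat_cond.
  apply: ler_sum => i; rewrite andbT => /andP[_ ilen].
  rewrite -(tS i); apply: dg.
  - by rewrite /t mulr_ge0// ltW.
  - by rewrite -subr_gt0 tS.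
  - by rewrite -tn /t ler_wpM2r ?(ltW h0)// ler_nat.
apply/eqP; rewrite -subr_eq0 -normr_le0; apply/ler_addgt0Pr => e e0; rewrite add0r.
have gM : 0 <= g M - g 0.
  by have := dg _ _ (lexx 0) M0 (lexx M) => /(le_trans (normr_ge0 _)); rewrite pmulr_lge0 ?subr0.
pose n := Num.truncn ((g M - g 0) * M / e).
apply: (le_trans (key n)).
rewrite mulrA ler_pdivrMr// [leRHS]mulrC -ler_pdivrMr//.
exact/ltW/truncnS_gt.
Qed.

(** * Powers near infinity *)

(** The antiderivative is [x^(1 - p) / (1 - p)], which tends to [0] at infinity
because [1 - p < 0]. *)
Lemma integral_powR_tail (R : realType) (a p : R) : 1 < p -> 0 < a ->
  (\int[lebesgue_measure]_(x in `]a, +oo[) (x `^ (- p))%:E =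
   (a `^ (1 - p) / (p - 1))%:E)%E.
Proof.
move=> p1 a0.
have pm1 : 1 - p != 0 by rewrite lt_eqF// subr_lt0.
have dpow (x : R) : 0 < x ->
    is_derive x 1 ((1 - p)^-1 \*: (@powR R ^~ (1 - p))) (x `^ (- p)).
  move=> x0; have -> : x `^ (- p) = (1 - p)^-1 *: ((1 - p) * x `^ (1 - p - 1)).
    by rewrite /GRing.scale/= mulKf//; congr (_ `^ _); lra.
  by apply: is_deriveZ; exact: is_derive1_powR.
have pos_in (x : R) : a <= x -> 0 < x by apply: lt_le_trans.
rewrite integral_itv_obnd_cbnd; last first.
  apply/measurable_EFinP; apply: measurable_funTS; exact: measurable_powR.
rewrite (@ge0_continuous_FTC2y _ _ ((1 - p)^-1 \*: (@powR R ^~ (1 - p))) _ 0).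
- rewrite sub0e -EFinN; congr EFin.
  rewrite /= /GRing.scale/= -[p - 1]opprB invrN mulrN mulrC//.
- by move=> x _; exact: powR_ge0.
- apply: derivable_within_continuous => x; rewrite in_itv/= andbT => /pos_in x0.
  by apply: derivable_powR; rewrite in_itv/= andbT.
- rewrite -[X in _ --> X](scaler0 _ (1 - p)^-1); apply: cvgZr.
  apply/cvgr0Pnorm_lt => e e0; near=> x.
  have x0 : 0 < x by near: x; exact: nbhs_pinfty_gt.
  (* [x^(1 - p) < e] is [e^(1 / (1 - p)) < x], as [1 - p] is negative *)
  have xe : e `^ (1 - p)^-1 < x by near: x; exact: nbhs_pinfty_gt.
  rewrite ger0_norm ?powR_ge0//.
  have p10 : 0 < p - 1 by rewrite subr_gt0.
  have := @gt0_ltr_powR _ _ p10 (e `^ (1 - p)^-1) x.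
  rewrite !nnegrE powR_ge0 (ltW x0) xe => /(_ isT isT isT).
  rewrite -powRrM -[1 - p]opprB invrN mulNr mulVf ?gt_eqF//.
  rewrite powRN powRr1 ?ltW// powRN => h.
  by rewrite -ltf_pV2 ?posrE ?invr_gt0 ?powR_gt0// invrK.
- by move=> x /ltW /pos_in /dpow[].
- apply: cvg_at_right_filter.
  by apply/differentiable_continuous/derivable1_diffP; have [] := dpow _ a0.
- move=> x; rewrite in_itv/= andbT => /ltW /pos_in x0.
  by rewrite derive1E; have [] := dpow _ x0.
Unshelve. all: by end_near. Qed.

Lemma measurable_fun_powR d (T : measurableType d) (R : realType) (D : set T)
    (k : T -> R) r : measurable_fun D k -> measurable_fun D (fun t => k t `^ r).
Proof.
by move=> mk; apply: (measurableT_comp (f := fun u : R => u `^ r)).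
Qed.

(** * Primitives along a coordinate *)

(** Integrating from [-oo] rather than from [0] makes the primitive a function on
the whole line, whose increments over [[a, b)] need no sign condition; it is
used for functions that vanish where the coordinate is not positive.  It is
locked to keep unification from unfolding the integral. *)
HB.lock Definition primitive (R : realType) (d : measure_display)
    (L : measurableType d) (mu : {measure set L -> \bar R}) (i : L -> R)
    (g : L -> R) (x : R) : R :=
  Rintegral mu (i @^-1` `]-oo, x[) g.

Section coordinate.
Context {R : realType} {d : measure_display} {L : measurableType d}.
Variables (mu : {sigma_finite_measure set L -> \bar R}) (i : L -> R).
Hypothesis mi : measurable_fun setT i.
Hypothesis mui : forall A : set R, measurable A ->
  mu (i @^-1` A) = lebesgue_measure A.

Lemma measurable_preim (A : set R) : measurable A -> measurable (i @^-1` A).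
Proof. by move=> mA; rewrite -[X in measurable X]setTI; exact: mi. Qed.

Lemma measurable_preim_itv (j : interval R) : measurable (i @^-1` [set` j]).
Proof. by apply: measurable_preim; exact: measurable_itv. Qed.

(** Lebesgue measure is the pushforward of [mu] by [i]. *)
Lemma ge0_integral_coord (D : set R) (k : R -> \bar R) :
  measurable D -> measurable_fun D k -> (forall x, D x -> 0 <= k x)%E ->
  (\int[mu]_(t in i @^-1` D) k (i t) = \int[lebesgue_measure]_(x in D) k x)%E.
Proof.
move=> mD mk k0.
have mi' : measurable_fun setT (i : L -> measurableTypeR R) by exact: mi.
have /= <- := @ge0_integral_pushforward _ _ _ _ _ _ mi' mu D k mD mk.
  by apply: eq_measure_integral => A mA _; exact: mui.
by move=> x /set_mem; exact: k0.
Qed.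

(** The functions whose primitive exists as a finite nondecreasing function
on the line, starting from [0] at [0]. *)
Record density (g : L -> R) : Prop := Density {
  density_ge0 : forall t, 0 <= g t;
  density_measurable : measurable_fun setT g;
  density_supp : forall t, i t <= 0 -> g t = 0;
  density_fin : forall x : R, (\int[mu]_(t in i @^-1` `]-oo, x[) (g t)%:E < +oo)%E }.

Local Notation primitive := (primitive mu i).

Lemma density_emeasurable (g : L -> R) D : density g -> measurable_fun D (EFin \o g).
Proof.
by move=> dg; apply: measurable_funTS; apply/measurable_EFinP; exact: density_measurable.
Qed.

Section primitive.
Context {g : L -> R}.
Hypothesis dg : density g.

Let mg D : measurable_fun D (EFin \o g). Proof. exact: density_emeasurable. Qed.

Lemma primitiveE x :
  (primitive g x)%:E = (\int[mu]_(t in i @^-1` `]-oo, x[) (g t)%:E)%E.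
Proof.
rewrite primitive.unlock /Rintegral fineK// ge0_fin_numE ?density_fin//.
by apply: integral_ge0 => t _; rewrite lee_fin (density_ge0 dg).
Qed.

Lemma primitiveB a b : a <= b ->
  (primitive g b - primitive g a)%:E = (\int[mu]_(t in i @^-1` `[a, b[) (g t)%:E)%E.
Proof.
move=> ab.
have U : `]-oo, b[%classic = `]-oo, a[ `|` `[a, b[ :> set R.
  by apply: itv_bndbnd_setU; rewrite bnd_simp.
rewrite EFinB !primitiveE U preimage_setU ge0_integral_setU//; last 4 first.
- exact: measurable_preim_itv.
- exact: measurable_preim_itv.
- by move=> x _; rewrite lee_fin (density_ge0 dg).
- apply/disj_setPS => x [/=]; rewrite !in_itv/= => xa /andP[ax _].
  by move: xa; rewrite ltNge ax.
by rewrite addeAC -primitiveE subee ?add0e.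
Qed.

Lemma primitive_le0 x : x <= 0 -> primitive g x = 0.
Proof.
move=> x0; apply: EFin_inj; rewrite primitiveE integral0_eq// => t /=.
rewrite in_itv/= => tx; rewrite (density_supp dg)//.
by rewrite (le_trans (ltW tx)).
Qed.

Lemma primitive_nondecreasing : {homo primitive g : a b / a <= b}.
Proof.
move=> a b ab; rewrite -subr_ge0 -lee_fin primitiveB//.
by apply: integral_ge0 => t _; rewrite lee_fin (density_ge0 dg).
Qed.

Lemma primitive_ge0 x : 0 <= primitive g x.
Proof.
have [x0|x0] := leP x 0; first by rewrite primitive_le0.
by rewrite -(primitive_le0 (lexx 0)); exact/primitive_nondecreasing/ltW.
Qed.

Lemma measure_preim_itvco (a b : R) : a <= b -> mu (i @^-1` `[a, b[) = (b - a)%:E.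
Proof.
move=> ab; rewrite mui; last exact: measurable_itv.
rewrite lebesgue_measure_itv/= lte_fin.
by case: ltgtP ab => //= -> _; rewrite subrr.
Qed.

(** Absolute continuity of the integral: [[a, b)] has measure [b - a], so the
increment over it is small with [b - a]. *)
Lemma primitive_continuous : continuous (primitive g).
Proof.
move=> x; apply/cvgrPdist_lt => e e0.
(* [g] is integrable only below each point, whence the restriction *)
pose gx := g \_ (i @^-1` `]-oo, x + 1[).
have igx : mu.-integrable setT (EFin \o gx).
  rewrite /gx -restrict_EFin; apply/integrable_restrict => //.
    exact: measurable_preim_itv.
  rewrite setTI; apply/integrableP; split; first exact: mg.
  under eq_integral do rewrite /= ger0_norm ?(density_ge0 dg)//.
  exact: density_fin.
have [r [r0 rP]] := integral_normr_continuous igx e0.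
have small a b : a <= b -> b <= x + 1 -> b - a < r -> primitive g b - primitive g a < e.
  move=> ab bx1 bar.
  have mab : (mu (i @^-1` `[a, b[) < r%:E)%E by rewrite measure_preim_itvco.
  apply: le_lt_trans (rP _ (measurable_preim_itv _) mab).
  rewrite (@eq_Rintegral _ _ _ _ _ g).
    by rewrite /Rintegral -primitiveB.
  move=> t /set_mem /=; rewrite in_itv/= => /andP[_ tb].
  rewrite /gx patchE mem_set ?ger0_norm ?(density_ge0 dg)//=.
  by rewrite in_itv/= (lt_le_trans tb).
near=> y.
have yx1 : `|x - y| < Num.min 1 r.
  by near: y; apply: cvgr_dist_lt; rewrite // lt_min ltr01.
move: yx1; rewrite lt_min => /andP[y1 yr].
have [xy|/ltW yx] := leP x y.
  rewrite distrC ger0_norm ?subr_ge0 ?primitive_nondecreasing//.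
  rewrite distrC ger0_norm ?subr_ge0// in y1 yr.
  by apply: small => //; lra.
rewrite ger0_norm ?subr_ge0 ?primitive_nondecreasing//.
rewrite ger0_norm ?subr_ge0// in y1 yr.
by apply: small => //; lra.
Unshelve. all: by end_near. Qed.

Lemma primitive_ivt x s : 0 <= x -> 0 <= s <= primitive g x ->
  exists2 t, 0 <= t <= x & primitive g t = s.
Proof.
move=> x0 /andP[s0 sx].
have [||t] := @IVT R (primitive g) 0 x s x0.
- exact/continuous_subspaceT/primitive_continuous.
- by rewrite (primitive_le0 (lexx 0)) min_l ?primitive_ge0// max_r ?primitive_ge0// s0.
by rewrite in_itv/= => tx <-; exists t.
Qed.

Lemma measurable_primitive : measurable_fun setT (primitive g).
Proof. by apply: continuous_measurable_fun; exact: primitive_continuous. Qed.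

End primitive.

Lemma le_integral_weight g (w1 w2 : L -> R) D : density g -> measurable D ->
  measurable_fun setT w1 -> measurable_fun setT w2 ->
  (forall t, D t -> 0 <= w1 t <= w2 t) ->
  (\int[mu]_(t in D) (w1 t * g t)%:E <= \int[mu]_(t in D) (w2 t * g t)%:E)%E.
Proof.
move=> dg mD mw1 mw2 w12; have g0 := density_ge0 dg.
have mwg (w : L -> R) : measurable_fun setT w ->
    measurable_fun D (fun t => (w t * g t)%:E).
  move=> mw; apply: measurable_funTS; apply/measurable_EFinP.
  by apply: measurable_funM => //; exact: (density_measurable dg).
apply: ge0_le_integral => //; [|exact: mwg|exact: mwg|].
- by move=> t /w12 /andP[w0 _]; rewrite lee_fin mulr_ge0.
- by move=> t /w12 /andP[_ wle]; rewrite lee_fin ler_wpM2r.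
Qed.

Lemma integral_weight_cst g c D : density g -> measurable D -> 0 <= c ->
  (\int[mu]_(t in D) (c * g t)%:E = c%:E * \int[mu]_(t in D) (g t)%:E)%E.
Proof.
move=> dg mD c0; under eq_integral do rewrite EFinM.
apply: ge0_integralZl_EFin => //.
- by move=> t _; rewrite lee_fin (density_ge0 dg).
- exact: density_emeasurable.
Qed.

(** * The chain rule *)

Section chain_rule.
Context {g : L -> R} (dg : density g) {p : R} (p1 : 1 < p).
Let F := primitive g.
Let w t := p * F (i t) `^ (p - 1).

Let p0 : 0 < p. Proof. exact: lt_trans p1. Qed.
Let p10 : 0 <= p - 1. Proof. by rewrite subr_ge0 ltW. Qed.

Let F0 x : 0 <= F x. Proof. exact: primitive_ge0. Qed.

Let wF : {homo (fun x => p * F x `^ (p - 1)) : a b / a <= b}.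
Proof.
move=> a b ab; rewrite ler_wpM2l ?(ltW p0)// ge0_ler_powR ?nnegrE//.
exact: primitive_nondecreasing.
Qed.

Lemma measurable_powR_primitive r : measurable_fun setT (fun t => F (i t) `^ r).
Proof.
by apply: measurable_fun_powR; exact: (measurableT_comp (measurable_primitive dg)).
Qed.

Let mw : measurable_fun setT w.
Proof.
by apply: measurable_funM; [exact: measurable_cst|exact: measurable_powR_primitive].
Qed.

Let w0 t : 0 <= w t. Proof. by rewrite mulr_ge0 ?powR_ge0 ?ltW. Qed.

Lemma density_powR_primitive : density (fun t => w t * g t).
Proof.
split.
- by move=> x; rewrite mulr_ge0// (density_ge0 dg).
- by apply: measurable_funM => //; exact: (density_measurable dg).
- by move=> t t0; rewrite (density_supp dg)// mulr0.
- move=> x; have mD := measurable_preim_itv `]-oo, x[.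
  have c0 : 0 <= p * F x `^ (p - 1) by rewrite mulr_ge0 ?powR_ge0 ?ltW.
  apply: (@le_lt_trans _ _ ((p * F x `^ (p - 1)) * F x)%:E); last exact: ltry.
  rewrite EFinM (primitiveE dg) -integral_weight_cst//.
  apply: le_integral_weight => //.
  by move=> t /=; rewrite in_itv/= => tx; rewrite w0 wF ?ltW.
Qed.

Let K := primitive (fun t => w t * g t).

(** Over [[a, b)] the weight [w] lies between its values at [a] and at [b], and so
does the slope of [x^p] between [F a] and [F b]. *)
Let increment a b : a <= b ->
  `|(K b - F b `^ p) - (K a - F a `^ p)| <=
    (p * F b `^ (p - 1) - p * F a `^ (p - 1)) * (F b - F a).
Proof.
move=> ab; have mD := measurable_preim_itv `[a, b[.
have c0 x : 0 <= p * F x `^ (p - 1) by rewrite mulr_ge0 ?powR_ge0 ?ltW.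
have Kr : K b - K a <= p * F b `^ (p - 1) * (F b - F a).
  rewrite -lee_fin EFinM (primitiveB dg ab) -integral_weight_cst//.
  rewrite (primitiveB density_powR_primitive ab).
  apply: le_integral_weight => //.
  by move=> t /=; rewrite in_itv/= => /andP[_ tb]; rewrite w0 wF ?ltW.
have Kl : p * F a `^ (p - 1) * (F b - F a) <= K b - K a.
  rewrite -lee_fin EFinM (primitiveB dg ab) -integral_weight_cst//.
  rewrite (primitiveB density_powR_primitive ab).
  apply: le_integral_weight => //.
  by move=> t /=; rewrite in_itv/= => /andP[ta _]; rewrite c0 wF.
have /andP[Fl Fr] := powR_sub_bounds p1 (F0 a) (F0 b).
by rewrite ler_norml; apply/andP; split; lra.
Qed.

(** [K - F^p] has second-order increments with respect to [F], hence is constant.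
To read it as a function of the value [s] of [F], a point [tau s] with
[F (tau s) = s] is chosen; the choice does not matter, for [K - F^p] is constant
where [F] is. *)
Lemma primitive_powR x : K x = F x `^ p.
Proof.
have [x0|/ltW x0] := leP x 0.
  rewrite /K /F (primitive_le0 density_powR_primitive x0) (primitive_le0 dg x0).
  by rewrite powR0// gt_eqF.
have D0 : K 0 - F 0 `^ p = 0.
  rewrite /K /F (primitive_le0 density_powR_primitive) ?(primitive_le0 dg)//.
  by rewrite powR0 ?gt_eqF// subrr.
have /choice[tau tauP] : forall s, exists t, 0 <= s <= F x -> 0 <= t <= x /\ F t = s.
  move=> s; have [sx|] := pselect (0 <= s <= F x); last by exists 0.
  by have [t tx Ft] := primitive_ivt dg x0 sx; exists t.
have Ftau s : 0 <= s <= F x -> F (tau s) = s by move=> /tauP[].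
have same t u : t <= u -> F t = F u -> K t - F t `^ p = K u - F u `^ p.
  move=> tx Ft; apply/esym/eqP; rewrite -subr_eq0 -normr_le0.
  by apply: le_trans (increment tx) _; rewrite Ft !subrr mulr0.
pose D s := K (tau s) - F (tau s) `^ p.
have : D (F x) = D 0.
  apply: (@eq_of_small_increments _ _ (fun s => p * s `^ (p - 1))) => // r s r0 rs sx.
  have rx : 0 <= r <= F x by rewrite r0 (le_trans (ltW rs)).
  have sx' : 0 <= s <= F x by rewrite (le_trans r0 (ltW rs)).
  have rstau : tau r <= tau s.
    rewrite leNgt; apply/negP => /ltW /(primitive_nondecreasing dg).
    by rewrite -/F Ftau// Ftau// leNgt rs.
  have := increment rstau.
  by rewrite /D !Ftau.
have xx : 0 <= F x <= F x by rewrite F0 lexx.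
have x00 : 0 <= (0 : R) <= F x by apply/andP; split; [exact: lexx|exact: F0].
have [/andP[_ taux] Ftaux] := tauP _ xx.
have [/andP[tau0 _] Ftau0] := tauP _ x00.
have F00 : F 0 = 0 by exact: primitive_le0.
rewrite /D (same _ _ taux Ftaux) -(same _ _ tau0) ?D0 ?Ftau0 ?F00//.
exact: subr0_eq.
Qed.

End chain_rule.

(** * The balance between the power of the mean and the function *)

(** If [F n > 0], continuity gives for every small [e] a point [b] with [F b = e];
the zeros of [F] in [[0, n)] lie before [b], so the integral of [g] over them is
at most [F b = e].  If [F n = 0] the point [b = n] will do. *)
Lemma primitive_eq0_ae g : density g ->
  {ae mu, forall t, primitive g (i t) = 0 -> g t = 0}.
Proof.
move=> dg; set F := primitive g.
have F00 : F 0 = 0 by exact: primitive_le0.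
have mF : measurable_fun setT (fun t => F (i t)).
  exact: (measurableT_comp (measurable_primitive dg)).
pose A (n : nat) := i @^-1` `[0, n%:R[ `&` [set t | F (i t) = 0].
have mA n : measurable (A n).
  apply: measurableI; first exact: measurable_preim_itv.
  by rewrite -[X in measurable X]setTI; exact: (mF measurableT _ (measurable_set1 0)).
have g0 := density_ge0 dg.
have intA n : (\int[mu]_(t in A n) `|(g t)%:E| = 0)%E.
  under eq_integral do rewrite gee0_abs ?lee_fin//.
  apply/eqP; rewrite eq_le integral_ge0 ?andbT; last first.
    by move=> t _; rewrite lee_fin.
  apply/lee_addgt0Pr => e e0; rewrite add0e.
  have [b [b0 Ab Fb]] : exists b, [/\ 0 <= b, A n `<=` i @^-1` `[0, b[ & F b <= e].
    have [Fn0|] := leP (F n%:R) 0.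
      by exists n%:R; split; [|exact: subIsetl|rewrite (le_trans Fn0)// ltW].
    move=> Fn0.
    have [|b /andP[b0 bn] Fb] := @primitive_ivt _ dg n%:R (Num.min e (F n%:R)) (ler0n _ _).
      by rewrite le_min (ltW e0) (ltW Fn0)/= ge_min lexx orbT.
    exists b; split => //; last by rewrite /F Fb ge_min lexx.
    move=> t [/=]; rewrite !in_itv/= => /andP[-> _] Ft /=; rewrite ltNge; apply/negP.
    move=> /(primitive_nondecreasing dg); rewrite -/F Ft /F Fb leNgt.
    by rewrite lt_min e0 Fn0.
  apply: (@le_trans _ _ (\int[mu]_(t in i @^-1` `[0%R, b[) (g t)%:E)%E).
    apply: ge0_subset_integral => //; first exact: measurable_preim_itv.
    + exact: density_emeasurable.
    + by move=> t _; rewrite lee_fin.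
  by rewrite -(primitiveB dg b0) lee_fin -/F F00 subr0.
have /ae_foralln : forall n, {ae mu, forall t, A n t -> (g t)%:E = 0%E}.
  move=> n; have := (ae_eq_integral_abs mu (mA n) (@density_emeasurable _ (A n) dg)).1 (intA n).
  by [].
apply: filterS => t At Ft; have [t0|t0] := ltP (i t) 0.
  by rewrite (density_supp dg)// ltW.
apply: EFin_inj; apply: (At (Num.truncn (i t)).+1).
by split => //=; rewrite in_itv/= t0/=; exact: truncnS_gt.
Qed.

(** Tonelli's theorem for [x^(-p) k(t)] on the region [i t < x]; the line carries
its Borel sets and [L] its own sigma-algebra. *)
Lemma integral_powR_primitive k (p : R) : density k -> 1 < p ->
  (\int[lebesgue_measure]_(x in `]0%R, +oo[) (x `^ (- p) * primitive k x)%:E =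
   \int[mu]_t (k t * ((i t) `^ (1 - p) / (p - 1)))%:E)%E.
Proof.
move=> dk p1; have k0 := density_ge0 dk.
pose f (z : measurableTypeR R * L) :=
  (if i z.2 < z.1 then z.1 `^ (- p) * k z.2 else 0)%:E.
have f0 z : (0 <= f z)%E.
  by rewrite /f lee_fin; case: ifPn => // _; rewrite mulr_ge0 ?powR_ge0.
have mf : measurable_fun setT f.
  apply/measurable_EFinP; apply: measurable_fun_ifT => /=.
  - apply: measurable_fun_ltr; last exact: measurable_fst.
    exact: (measurableT_comp mi measurable_snd).
  - apply: measurable_funM.
      by apply: measurable_fun_powR; exact: measurable_fst.
    exact: (measurableT_comp (density_measurable dk) measurable_snd).
  - exact: measurable_cst.
have fub := @fubini_tonelli _ _ _ _ R lebesgue_measure mu f mf f0.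
have inner1 x : (\int[mu]_t f (x, t) = (x `^ (- p) * primitive k x)%:E)%E.
  rewrite EFinM (primitiveE dk) -ge0_integralZl_EFin; first last.
  - exact: powR_ge0.
  - exact: density_emeasurable.
  - by move=> t _; rewrite lee_fin.
  - exact: measurable_preim_itv.
  rewrite [RHS]integral_mkcond; apply: eq_integral => t _.
  rewrite /f /= patchE; case: ifPn => [itx|itx].
    by rewrite mem_set ?EFinM//= in_itv.
  by rewrite memNset//= in_itv/=; exact/negP.
have inner2 t : (\int[lebesgue_measure]_x f (x, t) =
    (k t * (i t `^ (1 - p) / (p - 1)))%:E)%E.
  have [t0|t0] := leP (i t) 0.
    rewrite (density_supp dk t0) mul0r integral0_eq// => x _.
    by rewrite /f /= (density_supp dk t0) mulr0 if_same.
  rewrite EFinM -(integral_powR_tail p1 t0) -ge0_integralZl_EFin//; last 2 first.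
  - by move=> x _; rewrite lee_fin powR_ge0.
  - apply/measurable_EFinP; apply: measurable_funTS; exact: measurable_powR.
  rewrite [RHS]integral_mkcond; apply: eq_integral => x _.
  rewrite /f /= patchE; case: ifPn => [itx|itx].
    by rewrite mem_set -?EFinM 1?mulrC//= in_itv/= andbT.
  by rewrite memNset//= in_itv/= andbT; exact/negP.
transitivity (\int[lebesgue_measure]_x \int[mu]_t f (x, t))%E.
  rewrite integral_mkcond; apply: eq_integral => x _.
  rewrite inner1 patchE; case: ifPn => //.
  rewrite notin_setE /= in_itv/= andbT => /negP; rewrite -leNgt => x0.
  by rewrite (primitive_le0 dk x0) mulr0.
by rewrite fub; apply: eq_integral => t _; exact: inner2.
Qed.

Local Notation J := (i @^-1` `]0, +oo[).

Let mJ : measurable J. Proof. exact: measurable_preim_itv. Qed.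

Definition mean (g : L -> R) (x : R) : R := x^-1 * primitive g x.

Section mean.
Context {g : L -> R} (dg : density g) {p : R} (p1 : 1 < p).

Let p0 : 0 < p. Proof. exact: lt_trans p1. Qed.
Let g0 := density_ge0 dg.

Lemma mean_ge0 x : 0 <= mean g x.
Proof.
have [x0|/ltW x0] := leP x 0; first by rewrite /mean (primitive_le0 dg x0) mulr0.
by rewrite mulr_ge0 ?invr_ge0 ?primitive_ge0.
Qed.

Lemma mean_powR x r : 0 < x -> mean g x `^ r = x `^ (- r) * primitive g x `^ r.
Proof.
move=> x0; rewrite /mean powRM ?primitive_ge0 ?invr_ge0 ?ltW//.
by rewrite -powR_inv1 ?ltW// -powRrM mulN1r.
Qed.

Lemma measurable_mean : measurable_fun setT (mean g).
Proof.
(* [x^-1] and [x `^ (-1)] differ for negative [x], where the primitive vanishes *)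
have -> : mean g = fun x => x `^ (-1) * primitive g x.
  apply/funext => x; have [x0|x0] := leP x 0.
    by rewrite /mean (primitive_le0 dg x0) !mulr0.
  by rewrite powR_inv1// ltW.
apply: measurable_funM; last exact: measurable_primitive.
exact: measurable_powR.
Qed.

Lemma measurable_mean_powR r : measurable_fun setT (fun x => mean g x `^ r).
Proof. by apply: measurable_fun_powR; exact: measurable_mean. Qed.

Lemma measurable_mean_coord r : measurable_fun setT (fun t => mean g (i t) `^ r).
Proof. exact: (measurableT_comp (measurable_mean_powR r)). Qed.

Lemma integral_mean_coord :
  (\int[mu]_(t in J) (mean g (i t) `^ p)%:E =
   \int[lebesgue_measure]_(x in `]0%R, +oo[) (mean g x `^ p)%:E)%E.
Proof.
apply: (@ge0_integral_coord _ (fun x => (mean g x `^ p)%:E)).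
- exact: measurable_itv.
- apply/measurable_EFinP; apply: measurable_funTS; exact: measurable_mean_powR.
- by move=> x _; rewrite lee_fin powR_ge0.
Qed.

(** Integration by parts in disguise: the chain rule rewrites [F^p] as the
primitive of [p F^(p-1) g], to which [integral_powR_primitive] applies.  Both
sides may be infinite. *)
Lemma integral_mean_powR :
  (\int[mu]_(t in J) (mean g (i t) `^ p)%:E =
   (p / (p - 1))%:E * \int[mu]_(t in J) (g t * mean g (i t) `^ (p - 1))%:E)%E.
Proof.
pose k t := p * primitive g (i t) `^ (p - 1) * g t.
have dk : density k by exact: density_powR_primitive.
have q0 : 0 <= p / (p - 1) by rewrite divr_ge0 ?subr_ge0 ?ltW.
rewrite integral_mean_coord.
transitivity (\int[lebesgue_measure]_(x in `]0%R, +oo[)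
    (x `^ (- p) * primitive k x)%:E)%E.
  apply: eq_integral => x /set_mem /=; rewrite in_itv/= andbT => x0.
  by rewrite (mean_powR _ x0) /k (primitive_powR dg p1).
rewrite (integral_powR_primitive dk p1) -ge0_integralZl_EFin//; first last.
- apply: measurable_funTS; apply/measurable_EFinP; apply: measurable_funM.
    exact: (density_measurable dg).
  exact: measurable_mean_coord.
- by move=> t _; rewrite lee_fin mulr_ge0 ?powR_ge0.
rewrite [RHS]integral_mkcond; apply: eq_integral => t _; rewrite patchE; case: ifPn.
  move=> /set_mem /=; rewrite in_itv/= andbT => t0.
  rewrite -EFinM (mean_powR _ t0) /k opprB; congr EFin.
  have : p - 1 != 0 by rewrite subr_eq0 gt_eqF.
  by move=> pm; field.
rewrite notin_setE /= in_itv/= andbT => /negP; rewrite -leNgt => t0.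
by rewrite (density_supp dk t0) mul0r.
Qed.

End mean.

(** * Hardy's inequality *)

Section hardy_inequality.
Context {p : R} (p1 : 1 < p).

Let p0 : 0 < p. Proof. exact: lt_trans p1. Qed.
Let pm0 : 0 < p - 1. Proof. by rewrite subr_gt0. Qed.
Let q := p / (p - 1).
Let q0 : 0 < q. Proof. exact: divr_gt0. Qed.

Lemma measurable_density_powR g r : density g ->
  measurable_fun setT (fun t => g t `^ r).
Proof.
by move=> dg; apply: measurable_fun_powR; exact: (density_measurable dg).
Qed.

Lemma measurable_density_mean g r : density g ->
  measurable_fun setT (fun t => g t * mean g (i t) `^ r).
Proof.
move=> dg; apply: measurable_funM; first exact: (density_measurable dg).
exact: measurable_mean_coord.
Qed.

Let eJ (k : L -> R) : measurable_fun setT k -> measurable_fun J (EFin \o k).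
Proof. by move=> mk; apply: measurable_funTS; exact/measurable_EFinP. Qed.

(** By Young's inequality and the balance, [p X <= q^p Z + (p - 1) X] for the
integrals [X] of [h^p] and [Z] of [g^p]; a finite [X] can be subtracted. *)
Lemma hardy_inequality_of_fin g : density g ->
  (\int[mu]_(t in J) (mean g (i t) `^ p)%:E < +oo)%E ->
  (\int[mu]_(t in J) (mean g (i t) `^ p)%:E <=
   (q `^ p)%:E * \int[mu]_(t in J) (g t `^ p)%:E)%E.
Proof.
move=> dg Xoo; have g0 := density_ge0 dg.
have mm := measurable_mean_coord dg p.
have mgm := measurable_density_mean (p - 1) dg.
have mgp := measurable_density_powR p dg.
have X0 : (0 <= \int[mu]_(t in J) (mean g (i t) `^ p)%:E)%E.
  by apply: integral_ge0 => t _; rewrite lee_fin powR_ge0.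
have Z0 : (0 <= \int[mu]_(t in J) (g t `^ p)%:E)%E.
  by apply: integral_ge0 => t _; rewrite lee_fin powR_ge0.
have qp0 : 0 < q `^ p by exact: powR_gt0.
have young : ((p * q)%:E * \int[mu]_(t in J) (g t * mean g (i t) `^ (p - 1))%:E <=
    (q `^ p)%:E * \int[mu]_(t in J) (g t `^ p)%:E +
    (p - 1)%:E * \int[mu]_(t in J) (mean g (i t) `^ p)%:E)%E.
  have gm0 t : 0 <= g t * mean g (i t) `^ (p - 1) by rewrite mulr_ge0 ?powR_ge0.
  have pq0 : 0 <= p * q by rewrite mulr_ge0 ?ltW.
  rewrite -!ge0_integralZl_EFin//; do ?[exact: eJ|exact: ltW];
    do ?[by move=> t _; rewrite lee_fin ?gm0 ?powR_ge0].
  rewrite -ge0_integralD//; do ?[exact/measurable_funeM/eJ];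
    do ?[by move=> t _; rewrite mule_ge0// lee_fin ?powR_ge0// ltW].
  apply: ge0_le_integral => //.
  - by move=> t _; rewrite -EFinM lee_fin mulr_ge0.
  - exact/measurable_funeM/eJ.
  - by apply: emeasurable_funD; exact/measurable_funeM/eJ.
  - move=> t _; rewrite -!EFinM -EFinD lee_fin.
    have := young_powR p1 (mulr_ge0 (ltW q0) (g0 t)) (mean_ge0 dg (i t)).
    by rewrite (powRM _ (ltW q0) (g0 t)) !mulrA.
have Xq := integral_mean_powR dg p1; rewrite -/q in Xq.
rewrite EFinM -muleA -Xq in young.
move: Xoo X0 Z0 young.
case: (\int[mu]_(t in J) (mean g (i t) `^ p)%:E)%E => [x| |]//.
case: (\int[mu]_(t in J) (g t `^ p)%:E)%E => [z| |]//.
  by rewrite -!EFinM -EFinD !lee_fin => _ _ _; lra.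
by move=> _ _ _ _; rewrite gt0_muley ?lte_fin// leey.
Qed.

Definition trunc (g : L -> R) (n : nat) (t : L) : R :=
  if n.+1%:R^-1 <= i t < n.+1%:R then g t else 0.

Lemma density_trunc g n : density g -> density (trunc g n).
Proof.
move=> dg; have g0 := density_ge0 dg.
have mt : measurable_fun setT (trunc g n).
  apply: measurable_fun_ifT; [|exact: (density_measurable dg)|exact: measurable_cst].
  apply: measurable_and.
    by apply: measurable_fun_ler => //; exact: measurable_cst.
  by apply: measurable_fun_ltr => //; exact: measurable_cst.
split => //.
- by move=> t; rewrite /trunc; case: ifPn.
- by move=> t t0; rewrite /trunc (density_supp dg t0) if_same.
- move=> x; apply: le_lt_trans (density_fin dg x).
  apply: ge0_le_integral => //.
  + exact: measurable_preim_itv.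
  + by move=> t _; rewrite lee_fin /trunc; case: ifPn.
  + by apply: measurable_funTS; exact/measurable_EFinP.
  + exact: density_emeasurable.
  + by move=> t _; rewrite lee_fin /trunc; case: ifPn.
Qed.

Lemma primitive_le g1 g2 x : density g1 -> density g2 ->
  (forall t, g1 t <= g2 t) -> primitive g1 x <= primitive g2 x.
Proof.
move=> dg1 dg2 g12; rewrite -lee_fin !primitiveE//.
apply: ge0_le_integral.
- exact: measurable_preim_itv.
- by move=> t _; rewrite lee_fin (density_ge0 dg1).
- exact: density_emeasurable.
- exact: density_emeasurable.
- by move=> t _; rewrite lee_fin.
Qed.

Lemma primitive_trunc g n x : density g -> n.+1%:R^-1 <= x -> x < n.+1%:R ->
  primitive (trunc g n) x = primitive g x - primitive g n.+1%:R^-1.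
Proof.
move=> dg nx xn; apply: EFin_inj.
rewrite (primitiveE (density_trunc n dg)) (primitiveB dg nx).
rewrite integral_mkcond [RHS]integral_mkcond; apply: eq_integral => t _.
rewrite !patchE /trunc; have [tx|xt] := ltP (i t) x.
  rewrite mem_set /=; last by rewrite in_itv.
  have [nt|tn] := leP n.+1%:R^-1 (i t).
    by rewrite mem_set /= ?(lt_trans tx xn)// in_itv/= nt tx.
  by rewrite memNset//= in_itv/= leNgt tn.
rewrite !memNset//= in_itv/=; first by rewrite [_ < x]ltNge xt andbF.
by rewrite ltNge xt.
Qed.

Lemma primitive_trunc_eq0 g n x : density g -> x <= n.+1%:R^-1 ->
  primitive (trunc g n) x = 0.
Proof.
move=> dg xn; apply: EFin_inj.
rewrite (primitiveE (density_trunc n dg)) integral0_eq// => t /=.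
by rewrite in_itv/= /trunc leNgt => tx; rewrite (lt_le_trans tx xn).
Qed.

Lemma trunc_le g n t : density g -> trunc g n t <= g t.
Proof. by move=> dg; rewrite /trunc; case: ifPn => // _; exact: (density_ge0 dg). Qed.

Lemma primitive_trunc_bounded g n x : density g ->
  primitive (trunc g n) x <= primitive g n.+1%:R.
Proof.
move=> dg; have dt := density_trunc n dg.
have le y : primitive (trunc g n) y <= primitive g y.
  by apply: primitive_le => // t; exact: trunc_le.
have [xn|/ltW nx] := leP x n.+1%:R.
  exact: le_trans (le x) (primitive_nondecreasing dg xn).
suff -> : primitive (trunc g n) x = primitive (trunc g n) n.+1%:R by [].
apply: subr0_eq; apply: EFin_inj; rewrite (primitiveB dt nx) integral0_eq// => t /=.
by rewrite in_itv/= /trunc => /andP[nt _]; rewrite [_ < n.+1%:R]ltNge nt andbF.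
Qed.

Lemma trunc_nondecreasing g t : density g -> {homo (trunc g)^~ t : n m / (n <= m)%N >-> n <= m}.
Proof.
move=> dg n m nm; rewrite /trunc; case: ifPn => [/andP[nt tn]|_].
  rewrite (le_trans _ nt) ?(lt_le_trans tn)//; first by rewrite ler_nat.
  by rewrite lef_pV2 ?posrE// ler_nat.
by case: ifPn => // _; exact: (density_ge0 dg).
Qed.

Lemma cvg_primitive_trunc g x : density g ->
  primitive (trunc g n) x @[n --> \oo] --> primitive g x.
Proof.
move=> dg; have [x0|x0] := leP x 0.
  rewrite (primitive_le0 dg x0); apply: cvg_near_cst; near=> n.
  exact: (primitive_le0 (density_trunc n dg) x0).
rewrite -[X in _ --> X]subr0 -(primitive_le0 dg (lexx 0)).
apply: (@cvg_trans _ (primitive g x - primitive g n.+1%:R^-1 @[n --> \oo])).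
  apply: near_eq_cvg; near=> n; apply/esym/primitive_trunc => //.
    rewrite invf_ple ?posrE//; near: n.
    exists (Num.truncn x^-1) => // n /= xn.
    by rewrite (le_trans (ltW (truncnS_gt _)))// ler_nat ltnS.
  near: n; exists (Num.truncn x) => // n /= xn.
  by rewrite (lt_le_trans (truncnS_gt _))// ler_nat ltnS.
apply: cvgB; first exact: cvg_cst.
apply: (@cvg_comp _ _ _ _ (primitive g)); first exact: cvg_harmonic.
exact: primitive_continuous.
Unshelve. all: by end_near. Qed.

(** The primitive of the truncation is zero up to [a = 1 / (n + 1)] and bounded by
[F (n + 1)], so [h^p] is dominated by a multiple of [x^(-p)] on [(a, oo)]. *)
Lemma integral_mean_trunc_fin g n : density g ->
  (\int[mu]_(t in J) (mean (trunc g n) (i t) `^ p)%:E < +oo)%E.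
Proof.
move=> dg; have dt := density_trunc n dg.
rewrite (integral_mean_coord dt).
pose a : R := n.+1%:R^-1; pose C := primitive g n.+1%:R `^ p.
have a0 : 0 < a by rewrite invr_gt0.
have C0 : 0 <= C by exact: powR_ge0.
have sub : `]a, +oo[ `<=` (`]0, +oo[ : set R).
  by move=> x /=; rewrite !in_itv/= !andbT; exact: lt_trans.
apply: (@le_lt_trans _ _ (C%:E * (a `^ (1 - p) / (p - 1))%:E)%E); last first.
  by rewrite -EFinM ltry.
rewrite -(integral_powR_tail p1 a0) -ge0_integralZl_EFin//; last 2 first.
- by move=> x _; rewrite lee_fin powR_ge0.
- by apply/measurable_EFinP; apply: measurable_funTS; exact: measurable_powR.
have -> : (\int[lebesgue_measure]_(x in `]0%R, +oo[) (mean (trunc g n) x `^ p)%:E =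
  \int[lebesgue_measure]_(x in `]a, +oo[) (mean (trunc g n) x `^ p)%:E)%E.
  rewrite integral_mkcond [RHS]integral_mkcond; apply: eq_integral => x _.
  rewrite !patchE; have [xa|ax] := leP x a.
    rewrite [in RHS]memNset /=; last by rewrite in_itv/= ltNge xa.
    case: ifPn => // _.
    by rewrite /mean (primitive_trunc_eq0 dg xa) mulr0 powR0// gt_eqF.
  have xa : x \in `]a, +oo[%classic by rewrite inE/= in_itv/= ax.
  by rewrite xa ifT//; apply/mem_set/sub/set_mem.
apply: ge0_le_integral => //.
- by move=> x _; rewrite lee_fin powR_ge0.
- by apply/measurable_EFinP; apply: measurable_funTS; exact: measurable_mean_powR.
- apply: measurable_funeM; apply/measurable_EFinP; apply: measurable_funTS.
  exact: measurable_powR.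
- move=> x /sub /=; rewrite in_itv/= andbT => x0.
  rewrite -EFinM lee_fin (mean_powR dt)// mulrC ler_wpM2r ?powR_ge0//.
  rewrite ge0_ler_powR ?nnegrE ?primitive_ge0 ?(ltW p0)//.
  exact: primitive_trunc_bounded.
Qed.

(** Monotone convergence along the truncations, to which
[hardy_inequality_of_fin] applies with a bound independent of [n]. *)
Lemma hardy_inequality g : density g ->
  (\int[mu]_(t in J) (mean g (i t) `^ p)%:E <=
   (q `^ p)%:E * \int[mu]_(t in J) (g t `^ p)%:E)%E.
Proof.
move=> dg; have dt n := density_trunc n dg; have g0 := density_ge0 dg.
pose u n t := (mean (trunc g n) (i t) `^ p)%:E.
have mu_ n : measurable_fun J (u n) by apply: eJ; exact: measurable_mean_coord.
have u0 n t : J t -> (0 <= u n t)%E by move=> _; rewrite lee_fin powR_ge0.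
have undec t : J t -> {homo u ^~ t : n m / (n <= m)%N >-> (n <= m)%E}.
  rewrite /= in_itv/= andbT => t0 n m nm; rewrite lee_fin.
  rewrite ge0_ler_powR ?nnegrE ?mean_ge0 ?(ltW p0)//.
  rewrite ler_wpM2l ?invr_ge0 ?(ltW t0)//.
  by apply: primitive_le => // s; exact: trunc_nondecreasing.
have ulim t : J t -> limn (u ^~ t) = (mean g (i t) `^ p)%:E.
  rewrite /= in_itv/= andbT => t0; apply/cvg_lim => //.
  apply: cvg_EFin; first by near=> n.
  have Fge0 := primitive_ge0 dg (i t).
  (* [y `^ p] is [1] for [y < 0], so it is continuous in [y] only away from [0] *)
  have [Ft0|Ft0] := eqVneq (primitive g (i t)) 0.
    apply: cvg_near_cst; near=> n; rewrite /= /mean Ft0.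
    suff -> : primitive (trunc g n) (i t) = 0 by [].
    apply/eqP; rewrite eq_le primitive_ge0 ?andbT// -Ft0.
    by apply: primitive_le => // s; exact: trunc_le.
  have mt0 : 0 < mean g (i t).
    by rewrite mulr_gt0 ?invr_gt0// lt_neqAle eq_sym Ft0.
  have powRc : {for mean g (i t), continuous (fun y : R => y `^ p)}.
    apply/differentiable_continuous/derivable1_diffP.
    by apply: derivable_powR; rewrite in_itv/= mt0.
  have mc : mean (trunc g n) (i t) @[n --> \oo] --> mean g (i t).
    by apply: cvgM; [exact: cvg_cst|exact: cvg_primitive_trunc].
  exact: (cvg_comp _ _ mc powRc).
have <- : (\int[mu]_(t in J) limn (u ^~ t) =
    \int[mu]_(t in J) (mean g (i t) `^ p)%:E)%E.
  by apply: eq_integral => t /set_mem; exact: ulim.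
have ucvg := @cvg_monotone_convergence _ _ _ mu _ mJ _ mu_ u0 undec.
rewrite (monotone_convergence mu mJ mu_ u0 undec).
apply: lime_le; first exact: (cvgP _ ucvg).
near=> n.
apply: le_trans (hardy_inequality_of_fin (dt n) (integral_mean_trunc_fin n dg)) _.
apply: lee_wpmul2l; first by rewrite lee_fin powR_ge0.
apply: ge0_le_integral => //.
- by move=> t _; rewrite lee_fin powR_ge0.
- by apply: eJ; exact: measurable_density_powR.
- by apply: eJ; exact: measurable_density_powR.
- move=> t _; rewrite lee_fin ge0_ler_powR ?nnegrE ?(ltW p0)//.
    exact: (density_ge0 (dt n)).
  exact: trunc_le.
Unshelve. all: by end_near. Qed.

(** * The identity *)

(** The remainder is almost everywhere the expression [w], nonnegative by Young's
inequality; integrating [w + p q g h^(p-1) = q^p g^p + (p - 1) h^p] and using the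
balance leaves [\int w + p X = q^p Z + (p - 1) X] with [X] and [Z] the finite
integrals of [h^p] and [g^p]. *)
Lemma hardy_identity_coord g : density g ->
  (\int[mu]_(t in J) (g t `^ p)%:E < +oo)%E ->
  ((q `^ p)%:E * \int[mu]_(t in J) (g t `^ p)%:E
    - \int[mu]_(t in J) (mean g (i t) `^ p)%:E =
   \int[mu]_(t in J) (if mean g (i t) == 0 then 0 else
      mean g (i t) `^ p * Phi p (q * g t / mean g (i t)))%:E)%E.
Proof.
move=> dg Zoo; have g0 := density_ge0 dg.
have mm r := measurable_mean_coord dg r.
have mgm := measurable_density_mean (p - 1) dg.
have mgp := measurable_density_powR p dg.
have m0 t : 0 <= mean g (i t) by exact: mean_ge0.
pose w t := q `^ p * g t `^ p + (p - 1) * mean g (i t) `^ p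
            - p * q * (g t * mean g (i t) `^ (p - 1)).
have w0 t : 0 <= w t.
  have := young_powR p1 (mulr_ge0 (ltW q0) (g0 t)) (m0 t).
  by rewrite (powRM _ (ltW q0) (g0 t)) /w subr_ge0 !mulrA.
have mw : measurable_fun setT w.
  apply: measurable_funB.
    by apply: measurable_funD; apply: measurable_funM => //; exact: measurable_cst.
  by apply: measurable_funM => //; exact: measurable_cst.
have remE t : (if mean g (i t) == 0 then 0 else
      mean g (i t) `^ p * Phi p (q * g t / mean g (i t))) =
    if 0 < mean g (i t) then w t else 0.
  rewrite lt_neqAle m0 andbT [0 == _]eq_sym; case: eqVneq => //= mn0.
  have E1 : mean g (i t) `^ p * (q * g t / mean g (i t)) `^ p = q `^ p * g t `^ p.
    have qg0 : 0 <= q * g t by rewrite mulr_ge0 ?(ltW q0).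
    rewrite -(powRM p (m0 t) (divr_ge0 qg0 (m0 t))).
    by rewrite mulrCA divff// mulr1 (powRM p (ltW q0) (g0 t)).
  have E2 : mean g (i t) `^ p * (q * g t / mean g (i t)) =
      q * (g t * mean g (i t) `^ (p - 1)).
    by rewrite -(mulr_powRB1 (m0 t) p0); field.
  rewrite /Phi /w -E1 -[p * q * _]mulrA -E2.
  by ring.
have -> : (\int[mu]_(t in J) (if mean g (i t) == 0 then 0 else
      mean g (i t) `^ p * Phi p (q * g t / mean g (i t)))%:E =
    \int[mu]_(t in J) (w t)%:E)%E.
  under eq_integral do rewrite remE.
  apply: ge0_ae_eq_integral => //.
  - apply: eJ; apply: measurable_fun_ifT => //.
    apply: measurable_fun_ltr; first exact: measurable_cst.
    exact: (measurableT_comp (measurable_mean dg)).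
  - exact: eJ.
  - by move=> t _; rewrite lee_fin; case: ifPn.
  - by move=> t _; rewrite lee_fin.
  apply: filterS (primitive_eq0_ae dg) => t Ft /=.
  rewrite in_itv/= andbT => t0; case: ifPn => //; rewrite -leNgt => mt0.
  have mE : mean g (i t) = 0 by apply/eqP; rewrite eq_le mt0 m0.
  have gt0 : g t = 0.
    apply: Ft; move/eqP: mE; rewrite /mean mulf_eq0 invr_eq0 gt_eqF//= => /eqP.
    by [].
  by rewrite /w mE gt0 powR0 ?gt_eqF// !(mul0r, mulr0) addr0 subrr.
have X0 : (0 <= \int[mu]_(t in J) (mean g (i t) `^ p)%:E)%E.
  by apply: integral_ge0 => t _; rewrite lee_fin powR_ge0.
have Z0 : (0 <= \int[mu]_(t in J) (g t `^ p)%:E)%E.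
  by apply: integral_ge0 => t _; rewrite lee_fin powR_ge0.
have W0 : (0 <= \int[mu]_(t in J) (w t)%:E)%E.
  by apply: integral_ge0 => t _; rewrite lee_fin.
have qp0 : 0 < q `^ p by exact: powR_gt0.
have balance : (\int[mu]_(t in J) (w t)%:E +
    (p * q)%:E * \int[mu]_(t in J) (g t * mean g (i t) `^ (p - 1))%:E =
    (q `^ p)%:E * \int[mu]_(t in J) (g t `^ p)%:E +
    (p - 1)%:E * \int[mu]_(t in J) (mean g (i t) `^ p)%:E)%E.
  have gm0 t : 0 <= g t * mean g (i t) `^ (p - 1) by rewrite mulr_ge0 ?powR_ge0.
  have pq0 : 0 <= p * q by rewrite mulr_ge0 ?ltW.
  rewrite -!ge0_integralZl_EFin//; do ?[exact: eJ|exact: ltW];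
    do ?[by move=> t _; rewrite lee_fin ?gm0 ?powR_ge0].
  rewrite -!ge0_integralD//; do ?[exact/measurable_funeM/eJ|exact: eJ];
    do ?[by move=> t _; rewrite ?mule_ge0// lee_fin ?powR_ge0// ltW].
  by apply: eq_integral => t _; rewrite -!EFinM -!EFinD /w subrK.
have := hardy_inequality dg.
have Xq := integral_mean_powR dg p1; rewrite -/q in Xq.
rewrite EFinM -muleA -Xq in balance.
move: Zoo X0 Z0 W0 balance.
case: (\int[mu]_(t in J) (mean g (i t) `^ p)%:E)%E => [x| |]//;
case: (\int[mu]_(t in J) (g t `^ p)%:E)%E => [z| |]//;
case: (\int[mu]_(t in J) (w t)%:E)%E => [y| |]//.
move=> _ _ _ _; rewrite -!EFinM -!EFinD => -[e] _.
by congr EFin; lra.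
Qed.

Local Notation restr f := (fun t => if 0 < i t then f t else 0).

Let restrP (f : L -> R) t : J t -> restr f t = f t.
Proof. by rewrite /= in_itv/= andbT => ->. Qed.

Lemma integral_restr (f : L -> R) x :
  (\int[mu]_(t in i @^-1` `]-oo, x[) (restr f t)%:E =
   \int[mu]_(t in i @^-1` `]0%R, x[) (f t)%:E)%E.
Proof.
rewrite integral_mkcond [RHS]integral_mkcond; apply: eq_integral => t _.
have memE (j : interval R) : (t \in i @^-1` [set` j]) = (i t \in j).
  by apply/idP/idP => [/set_mem|tj]; [|exact/mem_set].
by rewrite !patchE !memE !in_itv/=; case: (0 < i t) => //=; case: ifP.
Qed.

(** Integrability near [0] and up to any [x] comes from [f <= 1 + f^p]. *)
Lemma density_restr (f : L -> R) :
  (forall t, 0 < i t -> 0 <= f t) -> measurable_fun J f ->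
  (\int[mu]_(t in J) (`|f t| `^ p)%:E < +oo)%E -> density (restr f).
Proof.
move=> f0 mf fp; pose g t := restr f t.
have g0 t : 0 <= g t by rewrite /g; case: ifPn => // /f0.
have mg : measurable_fun setT g.
  have -> : g = f \_ J.
    apply/funext => t; rewrite /g patchE; case: ifPn => it0.
      by rewrite mem_set//= in_itv/= it0.
    by rewrite memNset//= in_itv/= andbT; exact/negP.
  by apply/(measurable_restrictT _ mJ).
split => //; first by move=> t; rewrite ltNge => ->.
move=> x; rewrite integral_restr.
have mI := measurable_preim_itv `]0, x[.
have IJ : i @^-1` `]0, x[ `<=` J.
  by move=> t /=; rewrite !in_itv/= => /andP[->].
have muI : (mu (i @^-1` `]0%R, x[) < +oo)%E.
  rewrite mui; last exact: measurable_itv.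
  by rewrite lebesgue_measure_itv/=; case: ifPn => _; rewrite ?ltry// -EFinB ltry.
have mfp : measurable_fun J (fun t => (`|f t| `^ p)%:E).
  apply/measurable_EFinP; apply: measurable_fun_powR.
  exact: (measurableT_comp (@normr_measurable R setT)).
have mfpI := measurable_funS mJ IJ mfp.
apply: (@le_lt_trans _ _ (\int[mu]_(t in i @^-1` `]0%R, x[) (cst 1 t + (`|f t| `^ p)%:E))%E).
  have mfI := measurable_funS mJ IJ mf.
  apply: ge0_le_integral => //.
  - by move=> t /IJ /=; rewrite in_itv/= andbT lee_fin => /f0.
  - exact/measurable_EFinP.
  - by apply: emeasurable_funD => //; exact: measurable_cst.
  - move=> t /IJ /=; rewrite in_itv/= andbT => /f0 ft0.
    rewrite -EFinD lee_fin ger0_norm//.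
    have [f1|/ltW f1] := leP (f t) 1; first by rewrite (le_trans f1)// lerDl powR_ge0.
    by rewrite (le_trans (le1r_powR f1 (ltW p1)))// lerDr.
rewrite ge0_integralD//.
rewrite integral_cst// mul1e lte_add_pinfty//.
by apply: le_lt_trans fp; apply: ge0_subset_integral.
Qed.

Lemma hardy_identity_halfline (f : L -> R)
    (h := fun x => x^-1 * Rintegral mu (i @^-1` `]0, x[) f) :
  (forall t, 0 < i t -> 0 <= f t) -> measurable_fun J f ->
  (\int[mu]_(t in J) (`|f t| `^ p)%:E < +oo)%E ->
  ((q `^ p)%:E * \int[mu]_(t in J) (f t `^ p)%:E
    - \int[mu]_(t in J) (h (i t) `^ p)%:E =
   \int[mu]_(t in J) (if h (i t) == 0 then 0 else
      h (i t) `^ p * Phi p (q * f t / h (i t)))%:E)%E.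
Proof.
move=> f0 mf fp; have dg := density_restr f0 mf fp.
have hE x : h x = mean (restr f) x.
  by rewrite /h /mean primitive.unlock /Rintegral integral_restr.
clearbody h.
have fE : (\int[mu]_(t in J) (f t `^ p)%:E = \int[mu]_(t in J) (restr f t `^ p)%:E)%E.
  by apply: eq_integral => t /set_mem Jt; rewrite (restrP f Jt).
have fpoo : (\int[mu]_(t in J) (restr f t `^ p)%:E < +oo)%E.
  apply: le_lt_trans fp; rewrite le_eqVlt; apply/orP; left; apply/eqP.
  apply: eq_integral => t /set_mem Jt; rewrite (restrP f Jt) ger0_norm// f0//.
  by move: Jt; rewrite /= in_itv/= andbT.
have hI : (\int[mu]_(t in J) (h (i t) `^ p)%:E =
    \int[mu]_(t in J) (mean (restr f) (i t) `^ p)%:E)%E.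
  by apply: eq_integral => t _; rewrite hE.
rewrite fE hI (hardy_identity_coord dg fpoo).
by apply: eq_integral => t /set_mem Jt; rewrite hE (restrP f Jt).
Qed.

End hardy_inequality.

End coordinate.

(** * Lebesgue measure on the line *)

Local Notation lebT R := (caratheodory_type (@wlength R idfun)^*%mu).

Lemma measurable_id_lebesgue (R : realType) :
  measurable_fun [set: lebT R] (id : lebT R -> R).
Proof. by move=> _ B mB; rewrite setTI; exact: sub_caratheodory. Qed.

Theorem theorem1 (R : realType) (p : R) (p_gt1 : 1 < p) (f : R -> R)
    (f_ge0 : forall x, 0 < x -> 0 <= f x)
    (f_meas : lebesgue_measurable_fun `]0, +oo[ f)
    (f_Lp : (\int[completed_lebesgue_measure]_(x in `]0%R, +oo[)
               (`|f x| `^ p)%:E < +oo)%E) :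
  hardy_identity p f /\
  (compactly_supported_on `]0, +oo[ f -> locally_bounded_on `]0, +oo[ f ->
   hardy_identity p f).
Proof.
suff id_f : hardy_identity p f by split.
apply: (@hardy_identity_halfline R _ (lebT R) completed_lebesgue_measure id) => //.
exact: measurable_id_lebesgue.
Qed.
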